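(* A formula $\phi$ over $\{\mathbf 0,\mathbf 1,\neg,\wedge,\vee,\rightarrow,\triangleleft\}$ (resp. over $\{\mathbf 0,\mathbf 1,\neg,\wedge,\vee,\rightsquigarrow\}$) is $\mathsf{G}^2(\rightarrow)$-valid (resp. $\mathsf{G}^2(\rightsquigarrow)$-valid) if and only if it has a $\mathcal T(\mathsf{G}^2)$ proof.
   Context: **Semantics.** On $[0,1]$ let $a\rightarrow_G b=1$ if $a\le b$ and $=b$ otherwise; let $b\triangleleft_G a=0$ if $b\le a$ and $=b$ otherwise. Formulas are built from a countable set $\mathsf{Prop}$ and constants $\mathbf 0,\mathbf 1$ with unary $\neg$ and binary $\wedge,\vee,\rightarrow$, $\triangleleft$ (co-implication), $\rightsquigarrow$ (weak implication). A valuation is a map $v=(v_1,v_2):\mathsf{Prop}\to[0,1]\times[0,1]$, extended by - $v(\mathbf 0)=(0,1)$, $v(\mathbf 1)=(1,0)$, $v(\neg\phi)=(v_2(\phi),v_1(\phi))$; - $v(\phi\wedge\psi)=(\min(v_1(\phi),v_1(\psi)),\max(v_2(\phi),v_2(\psi)))$; - $v(\phi\vee\psi)=(\max(v_1(\phi),v_1(\psi)),\min(v_2(\phi),v_2(\psi)))$; - $v(\phi\rightarrow\psi)=(v_1(\phi)\rightarrow_G v_1(\psi),\ v_2(\psi)\triangleleft_G v_2(\phi))$; - $v(\phi\triangleleft\psi)=(v_1(\phi)\triangleleft_G v_1(\psi),\ v_2(\psi)\rightarrow_G v_2(\phi))$; - $v(\phi\rightsquigarrow\psi)=(v_1(\phi)\rightarrow_G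 v_1(\psi),\ \min(v_1(\phi),v_2(\psi)))$. A formula over $\{\mathbf 0,\mathbf 1,\neg,\wedge,\vee,\rightarrow,\triangleleft\}$ is $\mathsf{G}^2(\rightarrow)$-valid iff $v(\phi)=(1,0)$ for all valuations $v$ (designated set $(1,0)^\uparrow$). A formula over $\{\mathbf 0,\mathbf 1,\neg,\wedge,\vee,\rightsquigarrow\}$ is $\mathsf{G}^2(\rightsquigarrow)$-valid iff $v_1(\phi)=1$ for all $v$ (designated set $(1,1)^\uparrow$). Here $(x,y)^\uparrow=\{(x',y')\in[0,1]^2:x\le x',\ y'\le y\}$. **Tableaux $\mathcal T(\mathsf{G}^2)$.** A tableau is a downward branching tree whose branches are non-empty sets of entries. Entries have the form $\mathfrak X\lesssim\mathfrak X'$ with $\lesssim\in\{<,\leqslant\}$, where each of $\mathfrak X,\mathfrak X'$ is either $\mathbf x:\phi$ with $\mathbf x\in\{1,2\}$ and $\phi$ a formula (denoting $v_{\mathbf x}(\phi)$), or a number $0$ or $1$. $\gtrsim\in\{>,\geqslant\}$ is the converse notation. A branch containing a premise may be extended by the conclusions; ''$|$'' denotes branching, a comma means all listed entries are added. In each rule, $\lesssim$ (resp. $\gtrsim$) denotes the same relation in premise and conclusion. Rules (premise $\Rightarrow$ conclusions): - Constants (for both $\bowtie\,=\,\lesssim$ and $\bowtie\,=\,\gtrsim$): $1:\mathbf 0\bowtie\mathfrak X\Rightarrow 0\bowtie\mathfrak X$; $1:\mathbf 1\bowtie\mathfrak X\Rightarrow1\bowtie\mathfrak X$; $2:\mathbf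 0\bowtie\mathfrak X\Rightarrow1\bowtie\mathfrak X$; $2:\mathbf 1\bowtie\mathfrak X\Rightarrow0\bowtie\mathfrak X$. - $\neg$ (same $\bowtie$): $1:\neg\phi\bowtie\mathfrak X\Rightarrow2:\phi\bowtie\mathfrak X$; $2:\neg\phi\bowtie\mathfrak X\Rightarrow1:\phi\bowtie\mathfrak X$. - $\wedge$: $1:\phi\wedge\phi'\gtrsim\mathfrak X\Rightarrow1:\phi\gtrsim\mathfrak X,\ 1:\phi'\gtrsim\mathfrak X$; $2:\phi\wedge\phi'\lesssim\mathfrak X\Rightarrow2:\phi\lesssim\mathfrak X,\ 2:\phi'\lesssim\mathfrak X$; $1:\phi\wedge\phi'\lesssim\mathfrak X\Rightarrow1:\phi\lesssim\mathfrak X\ |\ 1:\phi'\lesssim\mathfrak X$; $2:\phi\wedge\phi'\gtrsim\mathfrak X\Rightarrow2:\phi\gtrsim\mathfrak X\ |\ 2:\phi'\gtrsim\mathfrak X$. - $\vee$: $1:\phi\vee\phi'\lesssim\mathfrak X\Rightarrow1:\phi\lesssim\mathfrak X,\ 1:\phi'\lesssim\mathfrak X$; $2:\phi\vee\phi'\gtrsim\mathfrak X\Rightarrow2:\phi\gtrsim\mathfrak X,\ 2:\phi'\gtrsim\mathfrak X$; $1:\phi\vee\phi'\gtrsim\mathfrak X\Rightarrow1:\phi\gtrsim\mathfrak X\ |\ 1:\phi'\gtrsim\mathfrak X$; $2:\phi\vee\phi'\lesssim\mathfrak X\Rightarrow2:\phi\lesssim\mathfrak X\ |\ 2:\phi'\lesssim\mathfrak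 X$. - $\rightarrow$, first coordinate: $1:\phi\rightarrow\phi'\leqslant\mathfrak X\Rightarrow\mathfrak X\geqslant1\ |\ \mathfrak X<1,\ 1:\phi'\leqslant\mathfrak X,\ 1:\phi>1:\phi'$; $1:\phi\rightarrow\phi'<\mathfrak X\Rightarrow1:\phi'<\mathfrak X,\ 1:\phi>1:\phi'$; $1:\phi\rightarrow\phi'\gtrsim\mathfrak X\Rightarrow1:\phi\leqslant1:\phi'\ |\ 1:\phi'\gtrsim\mathfrak X$. The first-coordinate rules for $\rightsquigarrow$ are the same with $\rightsquigarrow$ in place of $\rightarrow$. - $\rightarrow$, second coordinate: $2:\phi\rightarrow\phi'\lesssim\mathfrak X\Rightarrow2:\phi'\leqslant2:\phi\ |\ 2:\phi'\lesssim\mathfrak X$; $2:\phi\rightarrow\phi'\geqslant\mathfrak X\Rightarrow\mathfrak X\leqslant0\ |\ \mathfrak X>0,\ 2:\phi'\geqslant\mathfrak X,\ 2:\phi'>2:\phi$; $2:\phi\rightarrow\phi'>\mathfrak X\Rightarrow2:\phi'>\mathfrak X,\ 2:\phi'>2:\phi$. - $\triangleleft$, first coordinate: $1:\phi\triangleleft\phi'\lesssim\mathfrak X\Rightarrow1:\phi\leqslant1:\phi'\ |\ 1:\phi\lesssim\mathfrak X$; $1:\phi\triangleleft\phi'>\mathfrak X\Rightarrow1:\phi>\mathfrak X,\ 1:\phi>1:\phi'$; $1:\phi\triangleleft\phi'\geqslant\mathfrak X\Rightarrow\mathfrak X\leqslant0\ |\ \mathfrak X>0,\ 1:\phi\geqslant\mathfrak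 X,\ 1:\phi>1:\phi'$. - $\triangleleft$, second coordinate: $2:\phi\triangleleft\phi'\gtrsim\mathfrak X\Rightarrow2:\phi\gtrsim\mathfrak X\ |\ 2:\phi'\leqslant2:\phi$; $2:\phi\triangleleft\phi'\leqslant\mathfrak X\Rightarrow\mathfrak X\geqslant1\ |\ \mathfrak X<1,\ 2:\phi\leqslant\mathfrak X,\ 2:\phi'>2:\phi$; $2:\phi\triangleleft\phi'<\mathfrak X\Rightarrow2:\phi<\mathfrak X,\ 2:\phi<2:\phi'$. - $\rightsquigarrow$, second coordinate: $2:\phi\rightsquigarrow\phi'\lesssim\mathfrak X\Rightarrow1:\phi\lesssim\mathfrak X\ |\ 2:\phi'\lesssim\mathfrak X$; $2:\phi\rightsquigarrow\phi'\gtrsim\mathfrak X\Rightarrow1:\phi\gtrsim\mathfrak X,\ 2:\phi'\gtrsim\mathfrak X$. A branch $\mathcal B$ is closed iff at least one of the following holds: (i) the transitive closure of $\mathcal B$ under $\lesssim$ (where a chain with at least one strict step yields $<$, otherwise $\leqslant$) contains $\mathfrak X<\mathfrak X$ for some $\mathfrak X$; (ii) $\mathcal B$ itself contains $0\geqslant1$, or $\mathfrak X>1$ for some $\mathfrak X$, or $\mathfrak X<0$ for some $\mathfrak X$. A tableau is closed iff all its branches are closed. $\phi$ has a $\mathcal T(\mathsf{G}^2)$ proof iff there is a closed tableau starting from $1:\phi<1$.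
   Formalization: Closure condition (ii) (0≥1, X>1 or X<0) is tested on the transitive closure of the branch instead of the branch itself; as written, completeness fails, e.g. for the valid formula (y⇝x)∨((y⇝0)⇝0), whose branch x<y≤0 stays open. *)

(* Defs.v *)
From HB Require Import structures.
From mathcomp Require Import all_boot all_order all_algebra.
From mathcomp Require Import boolp reals.

Set Implicit Arguments.
Unset Strict Implicit.
Unset Printing Implicit Defensive.

Import Order.TTheory GRing.Theory Num.Theory.

(* Imp is the implication, Coimp the co-implication (Coimp a b has value
   a -< b), Wimp the weak implication. *)
Inductive fml (V : Type) : Type :=
| Var of V
| Bot
| Top
| Neg of fml V
| And of fml V & fml V
| Or of fml V & fml V
| Imp of fml V & fml V
| Coimp of fml V & fml V
| Wimp of fml V & fml V.

Arguments Bot {V}.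
Arguments Top {V}.

Fixpoint arrow_form (V : Type) (f : fml V) : bool :=
  match f with
  | Var _ | Bot | Top => true
  | Neg a => arrow_form a
  | And a b | Or a b | Imp a b | Coimp a b => arrow_form a && arrow_form b
  | Wimp _ _ => false
  end.

Fixpoint weak_form (V : Type) (f : fml V) : bool :=
  match f with
  | Var _ | Bot | Top => true
  | Neg a => weak_form a
  | And a b | Or a b | Wimp a b => weak_form a && weak_form b
  | Imp _ _ | Coimp _ _ => false
  end.

Section Semantics.
Local Open Scope ring_scope.
Variable R : realType.

Definition gimp (a b : R) : R := if a <= b then 1 else b.

Definition gcoimp (b a : R) : R := if b <= a then 0 else b.

Definition valuation (V : Type) (v : V -> R * R) : Prop :=
  forall p, (0 <= (v p).1 <= 1) /\ (0 <= (v p).2 <= 1).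

Fixpoint eval (V : Type) (v : V -> R * R) (f : fml V) : R * R :=
  match f with
  | Var p => v p
  | Bot => (0, 1)
  | Top => (1, 0)
  | Neg a => ((eval v a).2, (eval v a).1)
  | And a b => (Num.min (eval v a).1 (eval v b).1,
                Num.max (eval v a).2 (eval v b).2)
  | Or a b => (Num.max (eval v a).1 (eval v b).1,
               Num.min (eval v a).2 (eval v b).2)
  | Imp a b => (gimp (eval v a).1 (eval v b).1,
                gcoimp (eval v b).2 (eval v a).2)
  | Coimp a b => (gcoimp (eval v a).1 (eval v b).1,
                  gimp (eval v b).2 (eval v a).2)
  | Wimp a b => (gimp (eval v a).1 (eval v b).1,
                 Num.min (eval v a).1 (eval v b).2)
  end.

Definition arrow_valid (V : Type) (f : fml V) : Prop :=
  forall v : V -> R * R, valuation v -> eval v f = (1, 0).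

Definition weak_valid (V : Type) (f : fml V) : Prop :=
  forall v : V -> R * R, valuation v -> (eval v f).1 = 1.

End Semantics.

(* C1 f is "1 : f", C2 f is "2 : f"; T0 and T1 are the numbers 0 and 1. *)
Inductive term (V : Type) : Type :=
| C1 of fml V
| C2 of fml V
| T0
| T1.

Arguments T0 {V}.
Arguments T1 {V}.

(* [Entry x true y] is x < y and [Entry x false y] is x <= y. *)
Inductive entry (V : Type) : Type := Entry of term V & bool & term V.

(* Classical decidable equality, used only for membership in sequences. *)
HB.instance Definition _ (V : Type) := gen_eqMixin (entry V).

Declare Scope tableau_scope.
Delimit Scope tableau_scope with tab.
Notation "x < y" := (Entry x true y) : tableau_scope.
Notation "x <= y" := (Entry x false y) : tableau_scope.
Notation "x > y" := (Entry y true x) (only parsing) : tableau_scope.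
Notation "x >= y" := (Entry y false x) (only parsing) : tableau_scope.
Reserved Notation "x <~[ s ] y" (at level 70, no associativity).
Reserved Notation "x >~[ s ] y" (at level 70, no associativity).
Notation "x <~[ s ] y" := (Entry x s y) : tableau_scope.
Notation "x >~[ s ] y" := (Entry y s x) (only parsing) : tableau_scope.

Section Rules.
Variable V : Type.
Implicit Types (a b : fml V) (X : term V) (s : bool).
Local Open Scope tableau_scope.

(* [rule e alts]: a branch containing e may be split into one branch for each
   element of alts, all the entries of which are added to that branch. *)
Inductive rule : entry V -> seq (seq (entry V)) -> Prop :=
(* constants *)
| r_bot1_le s X : rule (C1 Bot <~[s] X) [:: [:: T0 <~[s] X]]
| r_bot1_ge s X : rule (C1 Bot >~[s] X) [:: [:: T0 >~[s] X]]
| r_top1_le s X : rule (C1 Top <~[s] X) [:: [:: T1 <~[s] X]]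
| r_top1_ge s X : rule (C1 Top >~[s] X) [:: [:: T1 >~[s] X]]
| r_bot2_le s X : rule (C2 Bot <~[s] X) [:: [:: T1 <~[s] X]]
| r_bot2_ge s X : rule (C2 Bot >~[s] X) [:: [:: T1 >~[s] X]]
| r_top2_le s X : rule (C2 Top <~[s] X) [:: [:: T0 <~[s] X]]
| r_top2_ge s X : rule (C2 Top >~[s] X) [:: [:: T0 >~[s] X]]
(* negation *)
| r_neg1_le s a X : rule (C1 (Neg a) <~[s] X) [:: [:: C2 a <~[s] X]]
| r_neg1_ge s a X : rule (C1 (Neg a) >~[s] X) [:: [:: C2 a >~[s] X]]
| r_neg2_le s a X : rule (C2 (Neg a) <~[s] X) [:: [:: C1 a <~[s] X]]
| r_neg2_ge s a X : rule (C2 (Neg a) >~[s] X) [:: [:: C1 a >~[s] X]]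
(* conjunction *)
| r_and1_ge s a b X :
    rule (C1 (And a b) >~[s] X) [:: [:: C1 a >~[s] X; C1 b >~[s] X]]
| r_and2_le s a b X :
    rule (C2 (And a b) <~[s] X) [:: [:: C2 a <~[s] X; C2 b <~[s] X]]
| r_and1_le s a b X :
    rule (C1 (And a b) <~[s] X) [:: [:: C1 a <~[s] X]; [:: C1 b <~[s] X]]
| r_and2_ge s a b X :
    rule (C2 (And a b) >~[s] X) [:: [:: C2 a >~[s] X]; [:: C2 b >~[s] X]]
(* disjunction *)
| r_or1_le s a b X :
    rule (C1 (Or a b) <~[s] X) [:: [:: C1 a <~[s] X; C1 b <~[s] X]]
| r_or2_ge s a b X :
    rule (C2 (Or a b) >~[s] X) [:: [:: C2 a >~[s] X; C2 b >~[s] X]]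
| r_or1_ge s a b X :
    rule (C1 (Or a b) >~[s] X) [:: [:: C1 a >~[s] X]; [:: C1 b >~[s] X]]
| r_or2_le s a b X :
    rule (C2 (Or a b) <~[s] X) [:: [:: C2 a <~[s] X]; [:: C2 b <~[s] X]]
(* implication *)
| r_imp1_le a b X :
    rule (C1 (Imp a b) <= X)
      [:: [:: X >= T1]; [:: X < T1; C1 b <= X; C1 a > C1 b]]
| r_imp1_lt a b X :
    rule (C1 (Imp a b) < X) [:: [:: C1 b < X; C1 a > C1 b]]
| r_imp1_ge s a b X :
    rule (C1 (Imp a b) >~[s] X) [:: [:: C1 a <= C1 b]; [:: C1 b >~[s] X]]
| r_imp2_le s a b X :
    rule (C2 (Imp a b) <~[s] X) [:: [:: C2 b <= C2 a]; [:: C2 b <~[s] X]]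
| r_imp2_ge a b X :
    rule (C2 (Imp a b) >= X)
      [:: [:: X <= T0]; [:: X > T0; C2 b >= X; C2 b > C2 a]]
| r_imp2_gt a b X :
    rule (C2 (Imp a b) > X) [:: [:: C2 b > X; C2 b > C2 a]]
(* co-implication *)
| r_coimp1_le s a b X :
    rule (C1 (Coimp a b) <~[s] X) [:: [:: C1 a <= C1 b]; [:: C1 a <~[s] X]]
| r_coimp1_gt a b X :
    rule (C1 (Coimp a b) > X) [:: [:: C1 a > X; C1 a > C1 b]]
| r_coimp1_ge a b X :
    rule (C1 (Coimp a b) >= X)
      [:: [:: X <= T0]; [:: X > T0; C1 a >= X; C1 a > C1 b]]
| r_coimp2_ge s a b X :
    rule (C2 (Coimp a b) >~[s] X) [:: [:: C2 a >~[s] X]; [:: C2 b <= C2 a]]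
| r_coimp2_le a b X :
    rule (C2 (Coimp a b) <= X)
      [:: [:: X >= T1]; [:: X < T1; C2 a <= X; C2 b > C2 a]]
| r_coimp2_lt a b X :
    rule (C2 (Coimp a b) < X) [:: [:: C2 a < X; C2 a < C2 b]]
(* weak implication *)
| r_wimp1_le a b X :
    rule (C1 (Wimp a b) <= X)
      [:: [:: X >= T1]; [:: X < T1; C1 b <= X; C1 a > C1 b]]
| r_wimp1_lt a b X :
    rule (C1 (Wimp a b) < X) [:: [:: C1 b < X; C1 a > C1 b]]
| r_wimp1_ge s a b X :
    rule (C1 (Wimp a b) >~[s] X) [:: [:: C1 a <= C1 b]; [:: C1 b >~[s] X]]
| r_wimp2_le s a b X :
    rule (C2 (Wimp a b) <~[s] X) [:: [:: C1 a <~[s] X]; [:: C2 b <~[s] X]]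
| r_wimp2_ge s a b X :
    rule (C2 (Wimp a b) >~[s] X) [:: [:: C1 a >~[s] X; C2 b >~[s] X]].

End Rules.

Section Tableaux.
Variable V : Type.

(* A branch is the finite set of the entries listed in a sequence. *)
Definition branch := seq (entry V).

(* Every rule has one or two alternatives. The entries carried by a node are
   those added to the branch when its parent is expanded. *)
Inductive tableau : Type :=
| Tip
| Grow of branch & tableau
| Split of branch & tableau & branch & tableau.

Fixpoint is_tableau (B : branch) (t : tableau) : Prop :=
  match t with
  | Tip => True
  | Grow C t1 =>
      (exists2 e, e \in B & rule e [:: C]) /\ is_tableau (B ++ C) t1
  | Split C t1 D t2 =>
      [/\ exists2 e, e \in B & rule e [:: C; D],
          is_tableau (B ++ C) t1 & is_tableau (B ++ D) t2]
  end.

Fixpoint branches (B : branch) (t : tableau) : seq branch :=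
  match t with
  | Tip => [:: B]
  | Grow C t1 => branches (B ++ C) t1
  | Split C t1 D t2 => branches (B ++ C) t1 ++ branches (B ++ D) t2
  end.

(* Transitive closure of a branch; the boolean tells whether some step of the
   chain is strict. *)
Inductive chain (B : branch) : term V -> bool -> term V -> Prop :=
| chain_entry x s y : Entry x s y \in B -> chain B x s y
| chain_trans x s y s' z :
    chain B x s y -> chain B y s' z -> chain B x (s || s') z.

(* The clauses about the numbers 0 and 1 are tested on the transitive closure,
   not only on the entries of the branch: otherwise the unsatisfiable branch
   {1 <= 1:q, 1:q < 1:p} would be open, and the valid formula
   Imp (And (Coimp p q) (Coimp Top (Coimp Top q))) Bot would have no proof. *)
Definition closed_branch (B : branch) : Prop :=
  [\/ exists x, chain B x true x,
      chain B T1 false T0,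
      exists x, chain B T1 true x
    | exists x, chain B x true T0].

Definition closed_tableau (B : branch) (t : tableau) : Prop :=
  is_tableau B t /\ forall B', B' \in branches B t -> closed_branch B'.

Definition has_proof (f : fml V) : Prop :=
  exists t, closed_tableau [:: Entry (C1 f) true T1] t.

End Tableaux.

(* Main.v *)
Require Import Defs.
From mathcomp Require Import all_boot all_order all_algebra.
From mathcomp Require Import boolp reals.
From mathcomp Require Import zify lra.

(** Both halves reduce to one statement about every formula, whatever its
connectives: the first coordinate of [f] is always 1 iff [1 : f < 1] has a
closed tableau.  For weak implication this is the theorem.  For the
formulas with implication and co-implication, the map (x, y) |-> (1 - y, 1 - x)
on values commutes with their connectives ([eval_conflation]), so a first
coordinate that is always 1 forces a second coordinate that is always 0
([arrow_weak_valid]).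

Soundness: if the entries of a branch hold under a valuation, each rule leaves
at least one alternative that holds ([rule_sound]), so some branch of the
tableau holds, and a closed branch cannot hold ([holds_open]).

Completeness: suppose that no closed tableau starts from [1 : f < 1].  Both
sides of an entry can be expanded, again and again, while keeping the branch
free of closed tableaux; the process ends because conclusions are smaller than
premises ([saturate]).  The resulting branch is open, hence a consistent finite
set of order constraints, and ranking a term by the number of entries that start
strictly below it gives values in [0,1] for the propositional variables
([height_chain]).

It remains to see that all saturated entries are true in this model
([saturated_holds]).  The obvious induction meets an obstacle: the rules are not
invertible.  From [X < 1:(a -> b)] the branch may keep only [1:a <= 1:b], which
says that the implication has value 1 but not that [X] is below 1.  A strict
entry can thus be lost only if its left side has value 0 or its right side has
value 1 ([left_alts_holds], [right_alts_holds]).  The model compensates for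
this: an atomic term gets 0 or 1 only if a chain of the branch forces it, and
such a chain, extended by the strict entry, would close the branch.

The many rules are instances of a few: a compound term is, order-theoretically,
a copy, a minimum, a maximum, a residuum or a difference of one or two smaller
terms, and the rule that applies to an entry depends only on this shape, on the
side on which the term stands and on whether the entry is strict. *)

Set Implicit Arguments.
Unset Strict Implicit.
Unset Printing Implicit Defensive.

Import Order.TTheory GRing.Theory Num.Theory.

(** * The shape of a term and the rules it triggers *)

Section Shapes.
Variable V : Type.
Implicit Types (t u w X : term V) (s : bool) (e : entry V) (a : fml V).

Inductive shape : Type :=
| Atom
| Alias of term V
| Meet of term V & term V
| Join of term V & term V
| Res of term V & term V
| Diff of term V & term V.

Definition shape_of t : shape :=
  match t with
  | T0 | T1 | C1 (Var _) | C2 (Var _) => Atom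
  | C1 Bot | C2 Top => Alias T0
  | C1 Top | C2 Bot => Alias T1
  | C1 (Neg a) => Alias (C2 a)
  | C2 (Neg a) => Alias (C1 a)
  | C1 (And a b) => Meet (C1 a) (C1 b)
  | C2 (And a b) => Join (C2 a) (C2 b)
  | C1 (Or a b) => Join (C1 a) (C1 b)
  | C2 (Or a b) => Meet (C2 a) (C2 b)
  | C1 (Imp a b) | C1 (Wimp a b) => Res (C1 a) (C1 b)
  | C2 (Imp a b) => Diff (C2 b) (C2 a)
  | C1 (Coimp a b) => Diff (C1 a) (C1 b)
  | C2 (Coimp a b) => Res (C2 b) (C2 a)
  | C2 (Wimp a b) => Meet (C1 a) (C2 b)
  end.

Local Open Scope tableau_scope.

(** The alternatives that result from expanding the left side of an entry.  For
an atomic side there is no rule; one empty alternative, which changes nothing,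
lets both sides of every entry be treated as expandable. *)
Definition left_alts (sh : shape) s X : seq (seq (entry V)) :=
  match sh with
  | Atom => [:: [::]]
  | Alias u => [:: [:: u <~[s] X]]
  | Meet u w => [:: [:: u <~[s] X]; [:: w <~[s] X]]
  | Join u w => [:: [:: u <~[s] X; w <~[s] X]]
  | Res u w =>
      if s then [:: [:: w < X; w < u]]
      else [:: [:: T1 <= X]; [:: X < T1; w <= X; w < u]]
  | Diff u w => [:: [:: u <= w]; [:: u <~[s] X]]
  end.

Definition right_alts (sh : shape) s X : seq (seq (entry V)) :=
  match sh with
  | Atom => [:: [::]]
  | Alias u => [:: [:: X <~[s] u]]
  | Meet u w => [:: [:: X <~[s] u; X <~[s] w]]
  | Join u w => [:: [:: X <~[s] u]; [:: X <~[s] w]]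
  | Res u w => [:: [:: u <= w]; [:: X <~[s] w]]
  | Diff u w =>
      if s then [:: [:: X < u; w < u]]
      else [:: [:: X <= T0]; [:: T0 < X; X <= u; w < u]]
  end.

(** [=i] rather than equality because the two alternatives of the rules for
[2 : Coimp a b >= X] and its strict form come in the opposite order to those of
the other residua. *)
Lemma rule_alts e alts : rule e alts ->
  exists t s X,
    (e = (t <~[s] X) /\ alts =i left_alts (shape_of t) s X) \/
    (e = (X <~[s] t) /\ alts =i right_alts (shape_of t) s X).
Proof.
by case=> *; do 3!eexists; first [by left; split | by right; split
  | by right; split=> // C; rewrite !inE orbC].
Qed.

Lemma rule_left t s X : shape_of t <> Atom ->
  exists2 alts, rule (t <~[s] X) alts & alts =i left_alts (shape_of t) s X.
Proof.
by case: t => [[]|[]||] //= *; case: s; eexists; first [constructor | by []].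
Qed.

Lemma rule_right t s X : shape_of t <> Atom ->
  exists2 alts, rule (X <~[s] t) alts & alts =i right_alts (shape_of t) s X.
Proof.
by case: t => [[]|[]||] //= *; case: s; eexists;
  first [constructor | by [] | by move=> C; rewrite !inE orbC].
Qed.

End Shapes.

(** * Conclusions are smaller than premises *)

Section Size.
Variable V : Type.
Implicit Types (t X : term V) (s : bool) (e : entry V) (a : fml V).

Fixpoint fml_size a : nat :=
  match a with
  | Var _ | Bot | Top => 1
  | Neg b => (fml_size b).+1
  | And b c | Or b c | Imp b c | Coimp b c | Wimp b c =>
      (fml_size b + fml_size c).+1
  end.

(** The numbers have size 0, below every formula: the rules replace constants by
numbers, and the rules for residua and differences compare [X] with a number. *)
Definition term_size t : nat :=
  match t with C1 a | C2 a => fml_size a | T0 | T1 => 0 end.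

Definition entry_size e : nat :=
  let: Entry x _ y := e in term_size x + term_size y.

Lemma fml_size_gt0 a : 0 < fml_size a.
Proof. by case: a. Qed.

Lemma left_alts_size t s X :
  all (all (fun d => entry_size d < term_size t + term_size X))
      (left_alts (shape_of t) s X).
Proof.
have pos := fml_size_gt0.
by case: t => [[]|[]||] //= *; case: s => /=;
  repeat (apply/andP; split=> //); lia.
Qed.

Lemma right_alts_size t s X :
  all (all (fun d => entry_size d < term_size X + term_size t))
      (right_alts (shape_of t) s X).
Proof.
have pos := fml_size_gt0.
by case: t => [[]|[]||] //= *; case: s => /=;
  repeat (apply/andP; split=> //); lia.
Qed.

End Size.

(** * Semantics of the rules, and soundness *)

Section Truth.
Variables (R : realType) (V : Type) (v : V -> R * R).
Implicit Types (t u w X : term V) (s : bool) (e : entry V).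
Local Open Scope ring_scope.

Definition tval t : R :=
  match t with
  | C1 a => (eval v a).1
  | C2 a => (eval v a).2
  | T0 => 0
  | T1 => 1
  end.

Definition rel s (x y : R) : bool := if s then x < y else x <= y.

Definition holds e : bool := let: Entry x s y := e in rel s (tval x) (tval y).

(** The argument [x] is the value of an atom: its shape does not record it. *)
Definition shape_val (sh : shape V) (x : R) : R :=
  match sh with
  | Atom => x
  | Alias u => tval u
  | Meet u w => Num.min (tval u) (tval w)
  | Join u w => Num.max (tval u) (tval w)
  | Res u w => gimp (tval u) (tval w)
  | Diff u w => gcoimp (tval u) (tval w)
  end.

Lemma shape_valE t : tval t = shape_val (shape_of t) (tval t).
Proof. by case: t => [[]|[]||]. Qed.

Lemma eval_unit : valuation v -> forall a,
  0 <= (eval v a).1 <= 1 /\ 0 <= (eval v a).2 <= 1.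
Proof.
move=> v01; elim=> [p| | |a IH|a [IH1 IH2] b [IH3 IH4]|a [IH1 IH2] b [IH3 IH4]
  |a [IH1 IH2] b [IH3 IH4]|a [IH1 IH2] b [IH3 IH4]|a [IH1 IH2] b [IH3 IH4]] /=.
- exact: v01.
- by rewrite !lexx ler01.
- by rewrite !lexx ler01.
- by case: IH.
all: by rewrite /gimp /gcoimp ?minEle ?maxEle; split; case: ifPn => ?; lra.
Qed.

Lemma tval_unit t : valuation v -> 0 <= tval t <= 1.
Proof.
by move=> v01; case: t => [a|a||] /=; rewrite ?lexx ?ler01 //;
  case: (eval_unit v01 a).
Qed.

(** The bound on [X] matters: from [Res u w < X] one gets [w < u] because a
residuum with [u <= w] has value 1, which is not below [X]. *)
Lemma left_sound t s X : valuation v ->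
  holds (Entry t s X) -> has (all holds) (left_alts (shape_of t) s X).
Proof.
move=> v01; have /andP[X0 X1] := tval_unit X v01.
rewrite /= shape_valE; case: (shape_of t) => [|u|u w|u w|u w|u w] //=;
  case: s => /=; rewrite /gimp /gcoimp ?minEle ?maxEle ?andbT ?orbF //;
  try case: ifPn => ?; lra.
Qed.

Lemma right_sound t s X : valuation v ->
  holds (Entry X s t) -> has (all holds) (right_alts (shape_of t) s X).
Proof.
move=> v01; have /andP[X0 X1] := tval_unit X v01.
rewrite /= [tval t]shape_valE; case: (shape_of t) => [|u|u w|u w|u w|u w] //=;
  case: s => /=; rewrite /gimp /gcoimp ?minEle ?maxEle ?andbT ?orbF //;
  try case: ifPn => ?; lra.
Qed.

(** The converse of [left_sound], up to the defect of [Diff u w < X]: the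
alternative [u <= w] makes the left side 0 but does not put [X] above 0. *)
Lemma left_alts_holds t s X : valuation v -> shape_of t <> Atom V ->
  has (all holds) (left_alts (shape_of t) s X) ->
  s ==> (0 < tval t) -> holds (Entry t s X).
Proof.
move=> v01; have /andP[X0 X1] := tval_unit X v01.
have /andP[] := tval_unit t v01.
rewrite /= [tval t]shape_valE;
  case: (shape_of t) => [|u|u w|u w|u w|u w] //= + + _;
  case: s => /=; rewrite /gimp /gcoimp ?minEle ?maxEle ?andbT ?orbF //;
  try case: ifPn => ?; move=> *; lra.
Qed.

(** Dually, in [X < Res u w] the alternative [u <= w] makes the right side 1 but
does not put [X] below 1. *)
Lemma right_alts_holds t s X : valuation v -> shape_of t <> Atom V ->
  has (all holds) (right_alts (shape_of t) s X) ->
  s ==> (tval t < 1) -> holds (Entry X s t).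
Proof.
move=> v01; have /andP[X0 X1] := tval_unit X v01.
have /andP[] := tval_unit t v01.
rewrite /= [tval t]shape_valE;
  case: (shape_of t) => [|u|u w|u w|u w|u w] //= + + _;
  case: s => /=; rewrite /gimp /gcoimp ?minEle ?maxEle ?andbT ?orbF //;
  try case: ifPn => ?; move=> *; lra.
Qed.

Hypothesis v01 : valuation v.

Lemma rule_sound e alts : rule e alts -> holds e -> has (all holds) alts.
Proof.
move=> /rule_alts[t [s [X [[-> alts_eq]|[-> alts_eq]]]]] ?;
  rewrite (eq_has_r alts_eq).
- exact: left_sound.
- exact: right_sound.
Qed.

Lemma branch_sound T B : is_tableau B T -> all holds B ->
  exists2 B', B' \in branches B T & all holds B'.
Proof.
elim: T B => [|C T IH|C T1 IH1 D T2 IH2] B /=.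
- by exists B; rewrite ?inE.
- case=> -[e eB re] tT hB; apply: IH => //.
  by move: (rule_sound re (allP hB e eB)); rewrite all_cat hB /= orbF.
- case=> -[e eB re] tT1 tT2 hB.
  case/or3P: (rule_sound re (allP hB e eB)) => // h.
  + by have [|B' B'T] := IH1 _ tT1; rewrite ?all_cat ?hB //; exists B';
      rewrite ?mem_cat ?B'T.
  + by have [|B' B'T] := IH2 _ tT2; rewrite ?all_cat ?hB //; exists B';
      rewrite ?mem_cat ?B'T ?orbT.
Qed.

Lemma chain_sound B x s y :
  all holds B -> chain B x s y -> rel s (tval x) (tval y).
Proof.
move=> hB; elim=> [{}x {}s {}y /(allP hB)//|{}x {}s {}y s' z _ + _].
by case: s; case: s' => /=; lra.
Qed.

Lemma holds_open B : all holds B -> ~ closed_branch B.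
Proof.
move=> hB; have sound := chain_sound hB; have unit t := tval_unit t v01.
case=> [[x /sound/=]|/sound/=|[x /sound/=]|[x /sound/=]].
- by rewrite ltxx.
- by rewrite ler10.
- by case/andP: (unit x) => _ x1; rewrite ltNge x1.
- by case/andP: (unit x) => x0 _; rewrite ltNge x0.
Qed.

End Truth.

(** * Saturating a branch that has no closed tableau *)

Section Saturation.
Variable V : Type.
Implicit Types (t x y X : term V) (s : bool) (e d : entry V) (B C : branch V).

Definition refutable B := exists T, closed_tableau B T.

Lemma closed_refutable B : closed_branch B -> refutable B.
Proof. by exists (Tip V); split=> // B'; rewrite inE => /eqP->. Qed.

Lemma rule_refutable B e alts : e \in B -> rule e alts ->
  (forall C, C \in alts -> refutable (B ++ C)) -> refutable B.
Proof.
move=> eB re.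
have : (exists C, alts = [:: C]) \/ (exists C D, alts = [:: C; D]).
  by case: re; eauto.
case=> [[C ?]|[C [D ?]]]; subst alts => ref.
- have [|T [tT cT]] := ref C; first by rewrite inE.
  by exists (Grow C T); split=> //=; split=> //; exists e.
- have [|T1 [tT1 cT1]] := ref C; first by rewrite inE eqxx.
  have [|T2 [tT2 cT2]] := ref D; first by rewrite !inE eqxx orbT.
  exists (Defs.Split C T1 D T2); split=> /=; first by split=> //; exists e.
  by move=> B'; rewrite mem_cat => /orP[/cT1|/cT2].
Qed.

Lemma left_step B t s X : Entry t s X \in B -> ~ refutable B ->
  exists2 C, C \in left_alts (shape_of t) s X & ~ refutable (B ++ C).
Proof.
move=> eB nB; have [tA|tA] := pselect (shape_of t = Atom V).
  by exists [::]; rewrite ?tA ?inE ?cats0.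
have [alts re alts_eq] := rule_left s X tA; apply: contrapT => no.
apply: nB; apply: (rule_refutable eB re) => C; rewrite alts_eq => CA.
by apply: contrapT => nC; apply: no; exists C.
Qed.

Lemma right_step B t s X : Entry X s t \in B -> ~ refutable B ->
  exists2 C, C \in right_alts (shape_of t) s X & ~ refutable (B ++ C).
Proof.
move=> eB nB; have [tA|tA] := pselect (shape_of t = Atom V).
  by exists [::]; rewrite ?tA ?inE ?cats0.
have [alts re alts_eq] := rule_right s X tA; apply: contrapT => no.
apply: nB; apply: (rule_refutable eB re) => C; rewrite alts_eq => CA.
by apply: contrapT => nC; apply: no; exists C.
Qed.

(** An entry is saturated when both of its sides have been expanded and the
conclusions are saturated in turn.  Asking this of one entry at a time, instead
of the whole branch, makes the notion monotone in the branch, so that entries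
can be saturated one after the other, each by induction on its size. *)
Inductive saturated B : entry V -> Prop :=
  Saturated x s y C D of
    Entry x s y \in B &
    C \in left_alts (shape_of x) s y & (forall d, d \in C -> saturated B d) &
    D \in right_alts (shape_of y) s x & (forall d, d \in D -> saturated B d) :
  saturated B (Entry x s y).

Lemma saturatedS B B' e : {subset B <= B'} -> saturated B e -> saturated B' e.
Proof.
move=> sub; elim=> x s y C D /sub eB' CA _ IHC DA _ IHD.
exact: (Saturated eB' CA IHC DA IHD).
Qed.

(** If every alternative of a rule had a closed tableau, so would the branch;
hence each side of the entry has an alternative that can be added, and its
entries, being smaller, can be saturated by induction. *)
Lemma saturate e B : e \in B -> ~ refutable B ->
  exists B', [/\ {subset B <= B'}, ~ refutable B' & saturated B' e].
Proof.
have [n] := ubnP (entry_size e).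
elim: n e B => // n IH e B lt_e eB nB.
have saturate_all C B1 : all (fun d => entry_size d < n)%N C ->
    {subset C <= B1} -> ~ refutable B1 ->
    exists B', [/\ {subset B1 <= B'}, ~ refutable B' &
                  forall d, d \in C -> saturated B' d].
  elim: C B1 => [|d C IHC] B1 /=.
    by move=> _ _ nB1; exists B1; split=> // ?; rewrite in_nil.
  move=> /andP[lt_d lt_C] sub nB1.
  have [B2 [sub2 nB2 sat2]] := IH d B1 lt_d (sub _ (mem_head _ _)) nB1.
  have subC : {subset C <= B2}.
    by move=> c cC; apply/sub2/sub; rewrite inE cC orbT.
  have [B3 [sub3 nB3 sat3]] := IHC B2 lt_C subC nB2.
  exists B3; split=> // [c /sub2/sub3//|c]; rewrite inE => /predU1P[->|/sat3//].
  exact: saturatedS sub3 sat2.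
case: e lt_e eB => x s y; rewrite ltnS => lt_e eB.
have subr (A1 A2 : branch V) : {subset A1 <= A2 ++ A1}.
  by move=> d dA; rewrite mem_cat dA orbT.
have [C CA nC] := left_step eB nB.
have lt_C : all (fun d => entry_size d < n)%N C.
  apply/allP => d /(allP (allP (left_alts_size x s y) _ CA)).
  by move/leq_trans; apply.
have [B1 [sub1 nB1 sat1]] := saturate_all C (B ++ C) lt_C (subr C B) nC.
have subB1 d : d \in B -> d \in B1.
  by move=> dB; apply: sub1; rewrite mem_cat dB.
have [D DA nD] := right_step (subB1 _ eB) nB1.
have lt_D : all (fun d => entry_size d < n)%N D.
  apply/allP => d /(allP (allP (right_alts_size y s x) _ DA)).
  by move/leq_trans; apply.
have [B2 [sub2 nB2 sat2]] := saturate_all D (B1 ++ D) lt_D (subr D B1) nD.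
have subB2 d : d \in B1 -> d \in B2.
  by move=> dB; apply: sub2; rewrite mem_cat dB.
exists B2; split=> //; first by move=> d /subB1/subB2.
apply: (Saturated _ CA _ DA sat2); first exact/subB2/subB1.
by move=> d /sat1; apply: saturatedS.
Qed.

End Saturation.

(** * The model of an open branch *)

Section Countermodel.
Variables (R : realType) (V : Type) (B : branch V).
Hypothesis open : ~ closed_branch B.
Implicit Types (x y t : term V) (s : bool) (e : entry V).

Definition source e : term V := let: Entry x _ _ := e in x.

(** The terms strictly below [t], each counted once for every entry in which it
is the left side.  Counting entries makes the rank finite and bounded by the
length of the branch, and every term that starts a chain is counted. *)
Definition rank t : nat := count (fun e => `[< chain B (source e) true t >]) B.

Definition is_zero t : Prop := t = T0 \/ exists s, chain B t s T0.
Definition is_one t : Prop := t = T1 \/ exists s, chain B T1 s t.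

Local Open Scope ring_scope.

(** The rank, shifted and scaled to lie strictly between 0 and 1; the end values
are reserved for the terms that the branch forces to take them. *)
Definition height t : R :=
  if `[< is_zero t >] then 0
  else if `[< is_one t >] then 1
  else (rank t).+1%:R / (size B).+2%:R.

Definition model (p : V) : R * R := (height (C1 (Var p)), height (C2 (Var p))).

Lemma chain_source x s y : chain B x s y -> exists2 e, e \in B & source e = x.
Proof. by elim=> // {}x {}s {}y eB; exists (Entry x s y). Qed.

(** What is strictly below [x] is strictly below [y]; if the chain is strict
then [x] itself is one more term below [y], and it is not below [x] in an open
branch. *)
Lemma rank_chain x s y : chain B x s y -> (rank x + s <= rank y)%N.
Proof.
move=> xy.
have sub : subpred (fun e => `[< chain B (source e) true x >])
                   (fun e => `[< chain B (source e) true y >]).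
  by move=> e /asboolP ex; apply/asboolP; apply: chain_trans ex xy.
case: s xy => xy; last by rewrite addn0; apply: sub_count.
have [e eB ex] := chain_source xy.
rewrite /rank; move: sub.
set p := fun e => `[< chain B (source e) true x >].
set q := fun e => `[< chain B (source e) true y >] => sub.
have pe : ~~ p e.
  by apply/asboolPn; rewrite ex => xx; apply: open; constructor 1; exists x.
have qe : q e by apply/asboolP; rewrite ex.
case/splitPr: eB => B1 B2; rewrite !count_cat /= qe (negbTE pe).
have := sub_count sub B1; have := sub_count sub B2; lia.
Qed.

Lemma rank_size x : (rank x <= size B)%N.
Proof. exact: count_size. Qed.

Lemma zero_chain x s y : chain B x s y -> is_zero y -> is_zero x.
Proof.
move=> xy [yE|[s' y0]]; right; first by exists s; rewrite -yE.
by exists (s || s'); apply: chain_trans xy y0.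
Qed.

Lemma one_chain x s y : chain B x s y -> is_one x -> is_one y.
Proof.
move=> xy [xE|[s' x1]]; right; first by exists s; rewrite -xE.
by exists (s' || s); apply: chain_trans x1 xy.
Qed.

Lemma zero_not_one x : is_zero x -> ~ is_one x.
Proof.
have no10 s : ~ chain B T1 s T0.
  by case: s => c; apply: open; [constructor 4; exists T1 | constructor 2].
case=> [->|[s x0]] [//|[s' x1]]; first exact: no10 x1.
- by move=> x1; apply: (no10 s); rewrite -x1.
- exact: no10 (chain_trans x1 x0).
Qed.

Lemma strict_not_zero x y : chain B x true y -> ~ is_zero y.
Proof.
move=> xy [yE|[s y0]]; apply: open; constructor 4; exists x.
- by rewrite -yE.
- exact: chain_trans xy y0.
Qed.

Lemma strict_not_one x y : chain B x true y -> ~ is_one x.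
Proof.
move=> xy [xE|[s x1]]; apply: open; constructor 3; exists y.
- by rewrite -xE.
- by have := chain_trans x1 xy; rewrite orbT.
Qed.

Variant height_spec x : R -> Prop :=
| HeightZero of is_zero x : height_spec x 0
| HeightOne of is_one x : height_spec x 1
| HeightMid of ~ is_zero x & ~ is_one x :
    height_spec x ((rank x).+1%:R / (size B).+2%:R).

Lemma heightP x : height_spec x (height x).
Proof.
rewrite /height; case: asboolP => [|x0]; first exact: HeightZero.
by case: asboolP => [|x1]; [exact: HeightOne|exact: HeightMid].
Qed.

Lemma mid_gt0 n : 0 < n.+1%:R / (size B).+2%:R :> R.
Proof. by rewrite divr_gt0 ?ltr0Sn. Qed.

Lemma mid_lt1 n : (n <= size B)%N -> n.+1%:R / (size B).+2%:R < 1 :> R.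
Proof. by move=> le_n; rewrite ltr_pdivrMr ?ltr0Sn // mul1r ltr_nat. Qed.

Lemma height_gt0 x : ~ is_zero x -> 0 < height x.
Proof. by case: heightP => // *; rewrite ?ltr01 ?mid_gt0. Qed.

Lemma height_lt1 x : ~ is_one x -> height x < 1.
Proof. by case: heightP => // *; rewrite ?ltr01 ?mid_lt1 ?rank_size. Qed.

Lemma height_unit x : 0 <= height x <= 1.
Proof.
case: heightP => *; rewrite ?lexx ?ler01 //.
by rewrite !ltW ?mid_gt0 ?mid_lt1 ?rank_size.
Qed.

Lemma height_chain x s y : chain B x s y -> rel s (height x) (height y).
Proof.
move=> xy; have /andP[x_ge0 x_le1] := height_unit x.
have /andP[y_ge0 y_le1] := height_unit y.
have le_rank := rank_chain xy.
case: s xy le_rank => xy; rewrite ?addn1 ?addn0 /= => le_rank.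
- have y0 := strict_not_zero xy; have x1 := strict_not_one xy.
  case: (heightP x) => // _; first exact: height_gt0.
  case: (heightP y) => // _; first by rewrite mid_lt1 ?rank_size.
  by move=> _; rewrite ltr_pM2r ?invr_gt0 ?ltr0Sn // ltr_nat.
- have y0 := zero_chain xy; have x1 := one_chain xy.
  case: (heightP x) => //.
  + by move=> /x1; case: heightP => // /zero_not_one.
  + move=> x0 _; case: (heightP y) => // [/y0//|_|_ _].
      by rewrite ltW ?mid_lt1 ?rank_size.
    by rewrite ler_pM2r ?invr_gt0 ?ltr0Sn // ler_nat.
Qed.

Lemma model_valuation : valuation model.
Proof. by move=> p; split; apply: height_unit. Qed.

Lemma tval_atom t : shape_of t = Atom V -> tval model t = height t.
Proof.
case: t => [[]|[]||] //= _.
- by rewrite /height asboolT //; left.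
- have one1 : is_one T1 by left.
  by case: heightP => // /zero_not_one.
Qed.

(** By [left_alts_holds] and [right_alts_holds], the entry can only fail if both
sides are atoms, or if it is strict and every compound side has its extreme
value (0 on the left, 1 on the right).  Atoms are ordered as the branch says;
and against an extreme value on one side, an atom on the other cannot have the
same value, for the chain forcing it would close the branch. *)
Lemma saturated_holds e : saturated B e -> holds model e.
Proof.
elim=> {e} x s y C D eB CA _ hC DA _ hD.
have v01 := model_valuation.
have hL : has (all (holds model)) (left_alts (shape_of x) s y).
  by apply/hasP; exists C => //; apply/allP.
have hR : has (all (holds model)) (right_alts (shape_of y) s x).
  by apply/hasP; exists D => //; apply/allP.
have xy := chain_entry eB.
apply: contraT => nh.
have x_cases : shape_of x = Atom V \/ s /\ tval model x = 0.
  have [|xA] := pselect (shape_of x = Atom V); [by left | right].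
  have : ~~ (s ==> (0 < tval model x)).
    by apply: contra nh; apply: left_alts_holds.
  rewrite negb_imply -leNgt => /andP[-> x0]; split=> //.
  by apply/eqP; rewrite eq_le x0; case/andP: (tval_unit x v01).
have y_cases : shape_of y = Atom V \/ s /\ tval model y = 1.
  have [|yA] := pselect (shape_of y = Atom V); [by left | right].
  have : ~~ (s ==> (tval model y < 1)).
    by apply: contra nh; apply: right_alts_holds.
  rewrite negb_imply -leNgt => /andP[-> y1]; split=> //.
  by apply/eqP; rewrite eq_le y1 andbT; case/andP: (tval_unit y v01).
move: nh xy => /=.
case: x_cases y_cases => [xA|[-> ->]] [yA|[sT ->]].
- by rewrite !tval_atom // => /negP nh /height_chain.
- by rewrite tval_atom // sT /= => /negP nh /strict_not_one/height_lt1.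
- by rewrite tval_atom //= => /negP nh /strict_not_zero/height_gt0.
- by rewrite /= ltr01.
Qed.

End Countermodel.

(** * Conflation: the second coordinate of an arrow formula *)

Section Conflation.
Variables (R : realType) (V : Type).
Local Open Scope ring_scope.

Definition conflation (v : V -> R * R) (p : V) : R * R :=
  (1 - (v p).2, 1 - (v p).1).

Lemma conflation_valuation v : valuation v -> valuation (conflation v).
Proof. by move=> v01 p; have [] := v01 p => /=; split; lra. Qed.

(** Order reversal x |-> 1 - x exchanges minimum with maximum and residuum with
difference, and these are the operations that the two coordinates of each
connective pair up.  Weak implication pairs a residuum with a minimum, so there
the identity breaks down. *)
Lemma eval_conflation v f : arrow_form f ->
  eval (conflation v) f = (1 - (eval v f).2, 1 - (eval v f).1).
Proof.
elim: f => [p| | |a IH|a IHa b IHb|a IHa b IHb|a IHa b IHb|a IHa b IHb|//] //=.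
- by rewrite subrr subr0.
- by rewrite subrr subr0.
- by move=> /IH ->.
all: move=> /andP[/IHa -> /IHb ->] /=; congr pair;
  rewrite /gimp /gcoimp ?minEle ?maxEle; do 2!case: ifPn => ?; lra.
Qed.

Lemma arrow_weak_valid (f : fml V) :
  arrow_form f -> arrow_valid R f <-> weak_valid R f.
Proof.
move=> af; split=> valid v v01; first by rewrite valid.
have := valid _ (conflation_valuation v01).
rewrite eval_conflation //= => f2; have := valid v v01.
by case: (eval v f) f2 => x y /= f2 ->; congr pair; lra.
Qed.

End Conflation.

(** * Soundness and completeness *)

Lemma has_proof_sound (R : realType) (V : Type) (f : fml V) :
  has_proof f -> weak_valid R f.
Proof.
case=> T [tT cT] v v01; apply/eqP; apply: contraT => f1.
have [|B' /cT cB' hB'] := branch_sound v01 tT; last first.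
  by case: (holds_open v01 hB').
by rewrite /= andbT lt_neqAle f1; case: (eval_unit v01 f) => /andP[].
Qed.

Lemma has_proof_complete (R : realType) (V : Type) (f : fml V) :
  weak_valid R f -> has_proof f.
Proof.
move=> valid; apply: contrapT => nB.
have [B' [_ nB' sat]] := saturate (mem_head _ _) nB.
have open : ~ closed_branch B' by move=> /closed_refutable.
have := saturated_holds R open sat.
by rewrite /= valid ?ltxx //; apply: model_valuation.
Qed.

Theorem theorem2 (R : realType) (V : countType) (f : fml V) :
  (arrow_form f -> (arrow_valid R f <-> has_proof f)) /\
  (weak_form f -> (weak_valid R f <-> has_proof f)).
Proof.
have valid_proof : weak_valid R f <-> has_proof f.
  by split; [apply: has_proof_complete | apply: has_proof_sound].
split=> [af|_ //].
exact: iff_trans (arrow_weak_valid R af) valid_proof.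
Qed.
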